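(* Consider the problem $\min_{\Theta\in\mathcal{M}}\Psi(\Theta)$ with $\Psi(\Theta)=-\frac{1}{|\mathcal{S}|}\sum_{(x,y)\in\mathcal{S}}\log p(y|f(x,\Theta))$, and the Riemannian natural gradient descent (RNGD) algorithm described in the context with initial point $\theta^0$ and parameters $\sigma_0>0$, $\sigma_{\min}>0$, $\eta_1\in(0,1)$, $\eta_2>0$, $\gamma>1$. Suppose that: (i) $\Psi$ is bounded from below on the set $\mathcal{L}(\theta^0)$ of iterates generated by the algorithm, and $\Psi\circ R$ and its gradient $\nabla(\Psi\circ R)$ are $L$-Lipschitz continuous on $\mathcal{L}_{\rm enl}(\theta^0)=\bigcup_{\theta\in\mathcal{L}(\theta^0)}B_\theta(0,1/\sigma_{\min})$; (ii) $\|F_k\|_{\rm op}\le\kappa_{\rm fim}$ for all $k\ge 0$; (iii) for some $\kappa_{\rm ef},\kappa_{\rm eg}>0$, each $m_k$ is a $(\kappa_{\rm ef},\kappa_{\rm eg})$-fully linear model of $\Psi$ on $B_{\theta^k}(0,1/\sigma_k)$; (iv) for some $\epsilon_F>0$, the estimates $\Psi_k^0$ and $\Psi_k^{z^k}$ are $\epsilon_F$-accurate; (v) $\eta_2\ge\max\left\{\kappa_{\rm fim},\frac{16\kappa_{\rm ef}}{1-\eta_1}\right\}$ and $\epsilon_F\le\min\left\{\kappa_{\rm ef},\frac{1}{32}\eta_1\eta_2\right\}$. Then the sequence of iterates $\{\theta^k\}$ generated by the algorithm almost surely satisfies $$\liminf_{k\to\infty}\|\mathrm{grad}\,\Psi(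\theta^k)\|=0.$$
   Context: $\mathcal{M}\subseteq\mathbb{R}^{m\times n}$ is an embedded Riemannian manifold, $\mathcal{S}$ a finite set of data pairs $(x,y)$, $f(\cdot,\Theta)$ a parametrized input-output map, $p(y|z)$ a conditional density. $\Theta$ is identified with $\theta=\mathrm{vec}(\Theta)\in\mathbb{R}^r$, $r=mn$, and $T_\theta\mathcal{M}$ with a subspace of $\mathbb{R}^r$. $R$ is a retraction on $\mathcal{M}$ (smooth $R:T\mathcal{M}\to\mathcal{M}$ with $R_\theta(0)=\theta$, $\mathrm{D}R_\theta(0)=\mathrm{id}$). $\mathrm{grad}$ is the Riemannian gradient; $\nabla(\Psi\circ R_\theta)$ is the Euclidean gradient of the pull-back $\Psi\circ R_\theta$ on $T_\theta\mathcal{M}$. $B_\theta(0,\rho)=\{d\in T_\theta\mathcal{M}:\|d\|\le\rho\}$. $\|\cdot\|_{\rm op}$ is the operator norm. ''$\Psi\circ R$ is Lipschitz on $\mathcal{L}_{\rm enl}(\theta^0)$'' refers to the maps $\Psi\circ R_\theta$ on the balls $B_\theta(0,1/\sigma_{\min})$, $\theta\in\mathcal{L}(\theta^0)$. RNGD algorithm. At iteration $k=0,1,2,\dots$, given $\theta^k\in\mathcal{M}$ and $\sigma_k>0$: form a (random) estimate $g^k\in T_{\theta^k}\mathcal{M}$ of $\mathrm{grad}\,\Psi(\theta^k)$ and a (random) estimate $F_k$ (a symmetric positive semidefinite operator on $T_{\theta^k}\mathcal{M}$) of the Riemannian Fisher information matrix $\mathbb{E}_{P_x}\mathbb{E}_{P_{y|x}(\theta)}[\mathrm{grad}\log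 p(y|f(x,\theta))\,\mathrm{grad}\log p(y|f(x,\theta))^\top]$ or of its empirical version $\frac{1}{|\mathcal{S}|}\sum_{(x,y)\in\mathcal{S}}\mathrm{grad}\log p(y|f(x,\theta))\,\mathrm{grad}\log p(y|f(x,\theta))^\top$ at $\theta=\theta^k$. Set $\lambda_k=\sigma_k\|g^k\|$ and $$m_k(d)=\Psi_k^0+\langle g^k,d\rangle+\tfrac12\langle(F_k+\lambda_kI)d,d\rangle,\quad d\in T_{\theta^k}\mathcal{M},$$ $$d^k=\operatorname*{arg\,min}_{d\in T_{\theta^k}\mathcal{M}}m_k(d)=-(F_k+\lambda_kI)^{-1}g^k,\qquad z^k=R_{\theta^k}(d^k).$$ Here $\Psi_k^0$ and $\Psi_k^{z^k}$ are (random) estimates of $\Psi(\theta^k)$ and $\Psi(z^k)$. Set $\rho_k=\dfrac{\Psi_k^{z^k}-\Psi_k^0}{m_k(d^k)-\Psi_k^0}$. Update $\theta^{k+1}=z^k$ if $\rho_k\ge\eta_1$ and $\|g^k\|\ge\eta_2/\sigma_k$, and $\theta^{k+1}=\theta^k$ otherwise; and $\sigma_{k+1}=\max\{\sigma_{\min},\sigma_k/\gamma\}$ if $\rho_k\ge\eta_1$ and $\|g^k\|>\eta_2/\sigma_k$, and $\sigma_{k+1}=\gamma\sigma_k$ otherwise. Fully linear model: $m_k$ is a $(\kappa_{\rm ef},\kappa_{\rm eg})$-fully linear model of $\Psi$ on $B_{\theta^k}(0,1/\sigma_k)$ if for all $y\in B_{\theta^k}(0,1/\sigma_k)$, $$\|\nabla(\Psi\circ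 R_{\theta^k})(y)-\nabla m_k(y)\|\le\frac{\kappa_{\rm eg}}{\sigma_k},\qquad |\Psi\circ R_{\theta^k}(y)-m_k(y)|\le\frac{\kappa_{\rm ef}}{\sigma_k^2}.$$ Accurate estimates: $\Psi_k^0,\Psi_k^{z^k}$ are $\epsilon_F$-accurate if $|\Psi_k^0-\Psi(\theta^k)|\le\epsilon_F/\sigma_k^2$ and $|\Psi_k^{z^k}-\Psi(z^k)|\le\epsilon_F/\sigma_k^2$. *)

(* Defs.v *)
From HB Require Import structures.
From mathcomp Require Import all_boot all_order all_algebra finmap.
From mathcomp Require Import all_classical all_reals all_analysis.

Set Implicit Arguments.
Unset Strict Implicit.
Unset Printing Implicit Defensive.

Import Order.TTheory GRing.Theory Num.Theory.
Import numFieldNormedType.Exports.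

Local Open Scope classical_set_scope.
Local Open Scope ring_scope.

Section Frobenius.
Context {R : realType} {m n : nat}.
Implicit Types A B : 'M[R]_(m, n).

Definition frob_ip A B : R := \tr (A^T *m B).

(* The library norm `|A| on matrices is the max norm; the Riemannian
   (Frobenius) norm is this one. *)
Definition frob_norm A : R := Num.sqrt (frob_ip A A).

End Frobenius.

Section Smoothness.
Context {R : realType} {V W : normedModType R}.

(* C^k on U; meaningful for U open, where it is the usual notion (in finite
   dimension) since all iterated directional derivatives are required. *)
Fixpoint Ck (k : nat) (U : set V) (f : V -> W) : Prop :=
  match k with
  | 0 => forall x, U x -> {for x, continuous f}
  | k'.+1 => (forall x, U x -> differentiable f x) /\
             (forall v, Ck k' U (fun x => 'D_v f x))
  end.

Definition smooth_in (U : set V) (f : V -> W) : Prop := forall k, Ck k U f.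

(* Smoothness on an arbitrary subset: local existence of smooth extensions. *)
Definition smooth_on (A : set V) (f : V -> W) : Prop :=
  forall a, A a -> exists U : set V, exists F : V -> W,
    [/\ open U, U a, smooth_in U F & forall x, A x -> U x -> F x = f x].

(* Frechet differential at y of the restriction of h to the subspace S. *)
Definition diff_along (S : set V) (h : V -> W) (y : V) (L : V -> W) : Prop :=
  forall e : R, 0 < e ->
    \forall d \near (0 : V), S d -> `|h (y + d) - h y - L d| <= e * `|d|.

End Smoothness.

Section Manifold.
Context {R : realType} {m n : nat}.
Local Notation E := 'M[R]_(m, n).
Implicit Types (M V : set E) (Psi h : E -> R) (x v y d : E).

(* Slice charts: near each point, a diffeomorphism of open sets of E
   straightens M to a linear subspace of a fixed dimension. *)
Definition embedded_submanifold M : Prop :=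
  exists dim : nat, forall x, M x ->
    exists (U U' : set E) (phi psi : E -> E) (W : {vspace E}),
      [/\ [/\ open U, U x & open U'],
          smooth_in U phi /\ smooth_in U' psi,
          (forall a, U a -> U' (phi a) /\ psi (phi a) = a),
          (forall b, U' b -> U (psi b) /\ phi (psi b) = b) &
          \dim W = dim /\ forall a, U a -> (M a <-> phi a \in W)].

Definition curve_through M x (c : R -> E) : Prop :=
  exists2 e : R, 0 < e &
    [/\ c 0 = x, smooth_in (ball (0 : R) e) c & forall t, ball 0 e t -> M (c t)].

Definition tangent M x : set E :=
  [set v | exists2 c, curve_through M x c & derive1 c 0 = v].

Definition tangent_bundle M : set (E * E) :=
  [set p | M p.1 /\ tangent M p.1 p.2].

Definition tangent_ball M x (r : R) : set E :=
  [set d | tangent M x d /\ frob_norm d <= r].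

Definition differentiable_on_manifold M Psi : Prop :=
  forall x, M x -> exists2 G : E -> R,
    differentiable G x & \forall a \near x, M a -> G a = Psi a.

(* M carries the metric induced by the Frobenius inner product, and
   DPsi(x)[c'(0)] = (Psi o c)'(0) for curves c in M through x. *)
Definition is_rgrad M Psi x v : Prop :=
  tangent M x v /\
  forall c, curve_through M x c ->
    is_derive (0 : R) 1 (Psi \o c) (frob_ip v (derive1 c 0)).

Definition rgrad M Psi x : E := get (is_rgrad M Psi x).

Definition is_egrad V h y v : Prop := V v /\ diff_along V h y (frob_ip v).

(* Gradient of the restriction of h to the Euclidean space V. *)
Definition egrad V h y : E := get (is_egrad V h y).

Definition retraction M (retr : E -> E -> E) : Prop :=
  [/\ smooth_on (tangent_bundle M) (fun p : E * E => retr p.1 p.2),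
      forall x d, M x -> tangent M x d -> M (retr x d),
      forall x, M x -> retr x 0 = x &
      forall x, M x -> diff_along (tangent M x) (retr x) 0 id].

Definition op_norm V (F : E -> E) : R :=
  sup [set frob_norm (F d) | d in [set d | V d /\ frob_norm d <= 1]].

(* Symmetric positive semidefinite operator on V; only the values of F on V
   are relevant. *)
Definition sym_psd_on V (F : E -> E) : Prop :=
  [/\ forall u, V u -> V (F u),
      forall u v, V u -> V v -> frob_ip (F u) v = frob_ip u (F v) &
      forall u, V u -> 0 <= frob_ip (F u) u].

End Manifold.

Section Objective.
Context {R : realType} {m n : nat} {dY : measure_display}.
Context {X : choiceType} {Y : measurableType dY} {Z : Type}.

(* p z y stands for p(y|z), a density with respect to nu. *)
Definition conditional_density (nu : {measure set Y -> \bar R})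
    (p : Z -> Y -> R) : Prop :=
  forall z, [/\ measurable_fun setT (p z), forall y, 0 <= p z y &
                (\int[nu]_y (p z y)%:E = 1)%E].

Definition neg_log_likelihood (S : {fset X * Y}) (f : X -> 'M[R]_(m, n) -> Z)
    (p : Z -> Y -> R) (Theta : 'M[R]_(m, n)) : R :=
  - ((#|` S|%fset)%:R^-1 * \sum_(s <- S) ln (p (f s.1 Theta) s.2)).

End Objective.

Section RNGD.
Context {R : realType} {m n : nat}.
Local Notation E := 'M[R]_(m, n).

(* The model m_k, with lambda_k = sigma_k * ||g^k||. *)
Definition rngd_model (Psi0 sigma : R) (g : E) (F : E -> E) (d : E) : R :=
  Psi0 + frob_ip g d
  + 2^-1 * frob_ip (F d + (sigma * frob_norm g) *: d) d.

Definition argmin_on (V : set E) (h : E -> R) (d : E) : Prop :=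
  V d /\ forall d', V d' -> h d <= h d'.

(* One realization of the algorithm. *)
Record rngd_run (M : set E) (retr : E -> E -> E) (theta0 : E)
    (sigma0 sigma_min eta1 eta2 gamma : R)
    (theta : nat -> E) (sigma : nat -> R)
    (g : nat -> E) (F : nat -> {linear E -> E}) (Psi0 Psiz : nat -> R)
    (d z : nat -> E) : Prop := RngdRun {
  rngd_theta0 : theta 0%N = theta0 ;
  rngd_sigma0 : sigma 0%N = sigma0 ;
  rngd_g : forall k, tangent M (theta k) (g k) ;
  rngd_F : forall k, sym_psd_on (tangent M (theta k)) (F k) ;
  rngd_d : forall k, argmin_on (tangent M (theta k))
    (rngd_model (Psi0 k) (sigma k) (g k) (F k)) (d k) ;
  rngd_z : forall k, z k = retr (theta k) (d k) ;
  rngd_update : forall k,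
    let rho := (Psiz k - Psi0 k) /
      (rngd_model (Psi0 k) (sigma k) (g k) (F k) (d k) - Psi0 k) in
    theta k.+1 = (if (eta1 <= rho) && (eta2 / sigma k <= frob_norm (g k))
                  then z k else theta k) /\
    sigma k.+1 = (if (eta1 <= rho) && (eta2 / sigma k < frob_norm (g k))
                  then Num.max sigma_min (sigma k / gamma)
                  else gamma * sigma k)
}.

Definition fully_linear (M : set E) (retr : E -> E -> E) (Psi : E -> R)
    (kef keg : R) (theta : E) (sigma : R) (mk : E -> R) : Prop :=
  forall y, tangent_ball M theta sigma^-1 y ->
    frob_norm (egrad (tangent M theta) (Psi \o retr theta) y
               - egrad (tangent M theta) mk y) <= keg / sigma /\
    `|(Psi \o retr theta) y - mk y| <= kef / sigma ^+ 2.

Definition accurate (Psi : E -> R) (epsF sigma : R) (theta z : E)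
    (Psi0 Psiz : R) : Prop :=
  `|Psi0 - Psi theta| <= epsF / sigma ^+ 2 /\
  `|Psiz - Psi z| <= epsF / sigma ^+ 2.

(* h and its gradient are L-Lipschitz on A, where h is a function on the
   Euclidean space V and A is a subset of V. *)
Definition lipschitz_with_grad (V A : set E) (L : R) (h : E -> R) : Prop :=
  forall u v, A u -> A v ->
    `|h u - h v| <= L * frob_norm (u - v) /\
    frob_norm (egrad V h u - egrad V h v) <= L * frob_norm (u - v).

End RNGD.

(* Main.v *)
Require Import Defs.
From HB Require Import structures.
From mathcomp Require Import all_boot all_order all_algebra finmap.
From mathcomp Require Import all_classical all_reals all_analysis.
From mathcomp Require Import lra.
Import Order.TTheory GRing.Theory Num.Theory.
Import numFieldNormedType.Exports.
Local Open Scope classical_set_scope.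
Local Open Scope ring_scope.

Set Implicit Arguments.
Unset Strict Implicit.
Unset Printing Implicit Defensive.

(** The argument is deterministic on each realization where the hypotheses hold.
    Comparing the step with a multiple of -g^k shows that, when
    ||g^k|| >= eta2 / sigma_k, the model decreases by at least
    eta2 / (4 sigma_k^2). The accuracy constants are chosen so that such a step
    is always accepted and lowers Psi by a fixed multiple of 1 / sigma_k^2.
    As Psi is bounded below, the sigma_k of accepted steps, and hence all
    sigma_k, tend to infinity. Were ||grad Psi(theta^k)|| bounded away from zero,
    then ||g^k|| would be too, because grad Psi(theta) is the gradient at 0 of
    the pull-back and the model is fully linear; eventually every step would be
    accepted and sigma_k would stop growing, a contradiction. *)

(** * Frobenius inner product, and its comparison with the max norm that carries the topology *)

Section FrobeniusTheory.
Context {R : realType} {m n : nat}.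
Implicit Types A B C : 'M[R]_(m, n).

Lemma frob_ipE A B : frob_ip A B = \sum_i \sum_j A i j * B i j.
Proof.
rewrite /frob_ip /mxtrace exchange_big; apply: eq_bigr => j _.
by rewrite mxE; apply: eq_bigr => i _; rewrite mxE.
Qed.

Lemma frob_ipC A B : frob_ip A B = frob_ip B A.
Proof. by rewrite /frob_ip -mxtrace_tr trmx_mul trmxK. Qed.

Lemma frob_ipDr A B C : frob_ip A (B + C) = frob_ip A B + frob_ip A C.
Proof. by rewrite /frob_ip mulmxDr mxtraceD. Qed.

Lemma frob_ipZr A B (a : R) : frob_ip A (a *: B) = a * frob_ip A B.
Proof. by rewrite /frob_ip -scalemxAr mxtraceZ. Qed.

Lemma frob_ipNr A B : frob_ip A (- B) = - frob_ip A B.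
Proof. by rewrite -scaleN1r frob_ipZr mulN1r. Qed.

Lemma frob_ip0r A : frob_ip A 0 = 0.
Proof. by rewrite -(scale0r (0 : 'M[R]_(m, n))) frob_ipZr mul0r. Qed.

Lemma frob_ipDl A B C : frob_ip (A + B) C = frob_ip A C + frob_ip B C.
Proof. by rewrite !(frob_ipC _ C) frob_ipDr. Qed.

Lemma frob_ipZl A B (a : R) : frob_ip (a *: A) B = a * frob_ip A B.
Proof. by rewrite !(frob_ipC _ B) frob_ipZr. Qed.

Lemma frob_ipNl A B : frob_ip (- A) B = - frob_ip A B.
Proof. by rewrite !(frob_ipC _ B) frob_ipNr. Qed.

Lemma frob_ip_ge0 A : 0 <= frob_ip A A.
Proof.
by rewrite frob_ipE; do 2![apply: sumr_ge0 => ? _]; rewrite -expr2 sqr_ge0.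
Qed.

Lemma frob_norm_ge0 A : 0 <= frob_norm A.
Proof. exact: sqrtr_ge0. Qed.

Lemma sqr_frob_norm A : frob_norm A ^+ 2 = frob_ip A A.
Proof. by rewrite sqr_sqrtr // frob_ip_ge0. Qed.

Lemma sqr_entry_le_frob_ip A i j : A i j ^+ 2 <= frob_ip A A.
Proof.
rewrite frob_ipE (bigD1 i) //= (bigD1 j) //= -expr2 -addrA lerDl addr_ge0 //.
  by apply: sumr_ge0 => ? _; rewrite -expr2 sqr_ge0.
by do 2![apply: sumr_ge0 => ? _]; rewrite -expr2 sqr_ge0.
Qed.

Lemma frob_ip_eq0 A : frob_ip A A = 0 -> A = 0.
Proof.
move=> A0; apply/matrixP => i j; rewrite mxE; apply/eqP.
by rewrite -sqrf_eq0 eq_le sqr_ge0 -A0 sqr_entry_le_frob_ip.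
Qed.

Lemma frob_norm_eq0 A : frob_norm A = 0 -> A = 0.
Proof. by move=> A0; apply: frob_ip_eq0; rewrite -sqr_frob_norm A0 expr0n. Qed.

Lemma frob_norm0 : frob_norm (0 : 'M[R]_(m, n)) = 0.
Proof. by rewrite /frob_norm frob_ip0r sqrtr0. Qed.

Lemma frob_normZ A (a : R) : frob_norm (a *: A) = `|a| * frob_norm A.
Proof.
rewrite /frob_norm frob_ipZl frob_ipZr mulrA -expr2 sqrtrM ?sqr_ge0 //.
by rewrite sqrtr_sqr.
Qed.

Lemma frob_normN A : frob_norm (- A) = frob_norm A.
Proof. by rewrite -scaleN1r frob_normZ normrN1 mul1r. Qed.

(** Cauchy-Schwarz: with a, b the two norms and c the inner product, the squared norm of b A - a B
    is 2ab(ab - c), and ab can be divided out once the zero cases are removed. *)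
Lemma frob_ip_le A B : frob_ip A B <= frob_norm A * frob_norm B.
Proof.
have [A0|An0] := eqVneq (frob_norm A) 0.
  by rewrite A0 mul0r (frob_norm_eq0 A0) frob_ipC frob_ip0r.
have [B0|Bn0] := eqVneq (frob_norm B) 0.
  by rewrite B0 mulr0 (frob_norm_eq0 B0) frob_ip0r.
have a0 : 0 < frob_norm A by rewrite lt0r An0 frob_norm_ge0.
have b0 : 0 < frob_norm B by rewrite lt0r Bn0 frob_norm_ge0.
have := frob_ip_ge0 (frob_norm B *: A - frob_norm A *: B).
rewrite frob_ipDl !frob_ipDr !frob_ipNl !frob_ipNr !frob_ipZl !frob_ipZr.
rewrite (frob_ipC B A) -!sqr_frob_norm.
set a := frob_norm A in a0 *; set b := frob_norm B in b0 *.
set c := frob_ip A B => h; rewrite -subr_ge0 -(pmulr_rge0 _ (mulr_gt0 a0 b0)).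
nra.
Qed.

Lemma frob_norm_triangle A B : frob_norm (A + B) <= frob_norm A + frob_norm B.
Proof.
rewrite -(ler_pXn2r (n:=2)) // ?nnegrE ?addr_ge0 ?frob_norm_ge0 //.
rewrite sqr_frob_norm frob_ipDl !frob_ipDr (frob_ipC B A) -!sqr_frob_norm.
have := frob_ip_le A B; nra.
Qed.

Lemma entry_le_norm A i j : `|A i j| <= `|A|.
Proof.
by rewrite [leRHS]/Num.norm /= mx_normrE; apply/bigmax_geP; right; exists (i, j).
Qed.

Lemma norm_le_frob_norm A : `|A| <= frob_norm A.
Proof.
rewrite [leLHS]/Num.norm /= mx_normrE; apply/bigmax_leP.
split=> [|[i j] _]; first exact: frob_norm_ge0.
rewrite -(ler_pXn2r (n:=2)) // ?nnegrE ?frob_norm_ge0 //=.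
by rewrite sqr_frob_norm real_normK ?num_real // sqr_entry_le_frob_ip.
Qed.

Lemma norm_frob_ip_le A B : `|frob_ip A B| <= (m * n)%:R * (`|A| * `|B|).
Proof.
rewrite frob_ipE (le_trans (ler_norm_sum _ _ _)) //.
apply: (@le_trans _ _ (\sum_(i < m) n%:R * (`|A| * `|B|))).
  apply: ler_sum => i _; rewrite (le_trans (ler_norm_sum _ _ _)) //.
  apply: (@le_trans _ _ (\sum_(j < n) `|A| * `|B|)).
    by apply: ler_sum => j _; rewrite normrM ler_pM ?entry_le_norm.
  by rewrite sumr_const card_ord mulr_natl.
by rewrite sumr_const card_ord -[leLHS]mulr_natl mulrA -natrM.
Qed.

(** Expansion in matrix units. The summand 1 in the constant makes it strictly positive, so that
    later proofs can divide by it. *)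
Lemma linear_mx_bounded (W : normedModType R)
    (f : {linear 'M[R]_(m, n) -> W}) :
  exists2 K : R, 0 < K & forall A, `|f A| <= K * `|A|.
Proof.
exists (1 + \sum_i \sum_j `|f (delta_mx i j)|).
  by rewrite ltr_pwDl //; do 2![apply: sumr_ge0 => ? _].
move=> A; rewrite [in leLHS](matrix_sum_delta A) linear_sum.
rewrite (le_trans (ler_norm_sum _ _ _)) // mulrDl mul1r mulr_suml.
rewrite -[leLHS]add0r lerD //; apply: ler_sum => i _.
rewrite linear_sum (le_trans (ler_norm_sum _ _ _)) // mulr_suml.
by apply: ler_sum => j _; rewrite linearZ normrZ mulrC ler_wpM2l ?entry_le_norm.
Qed.

Lemma linear_mx_continuous (W : normedModType R)
    (f : {linear 'M[R]_(m, n) -> W}) : continuous f.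
Proof.
have [K K0 fK] := linear_mx_bounded f.
apply/linear_bounded_continuous/bounded_funP => r.
exists (K * r) => x xr; rewrite (le_trans (fK x)) // ler_wpM2l //.
exact: ltW.
Qed.

End FrobeniusTheory.

(** * Smooth maps along lines, and a chain rule for directional derivatives *)

Section SmoothCurves.
Context {R : realType} {V W : normedModType R}.

Lemma Ck_subset k (U U' : set V) (f : V -> W) :
  U' `<=` U -> Ck k U f -> Ck k U' f.
Proof.
move=> U'U; elim: k f => [|k IH] f /=; first by move=> fC x /U'U; exact: fC.
by move=> [fd fC]; split=> [x /U'U|v]; [exact: fd|apply: IH; exact: fC].
Qed.

Lemma derive_line (f : V -> W) (a b : V) (s t : R) :
  'D_s (fun t : R => f (a + t *: b)) t = 'D_(s *: b) f (a + t *: b).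
Proof.
rewrite /derive; set q := (fun h : R => h^-1 *: _).
set q' := (fun h : R => h^-1 *: _).
suff -> : q = q' by [].
by apply/funext => h; rewrite /q /q' /= scalerDl addrCA scalerA.
Qed.

Lemma differentiable_line (a b : V) (t : R) :
  differentiable (fun t : R => a + t *: b) t.
Proof.
apply: (@differentiableD _ _ _ (cst a) (fun t : R => t *: b)) => //.
Qed.

(** The induction closes because a derivative along the line is again a directional derivative of
    [f], in the fixed direction [s *: b], restricted to the same line. *)
Lemma Ck_line k (U : set V) (f : V -> W) (a b : V) :
  Ck k U f -> Ck k [set t : R | U (a + t *: b)] (fun t => f (a + t *: b)).
Proof.
elim: k f => [|k IH] f /=.
  move=> fC t Ut.
  apply: (@continuous_comp _ _ _ (fun t : R => a + t *: b) f); last exact: fC.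
  exact/differentiable_continuous/differentiable_line.
move=> [fd fC]; split=> [t Ut|s].
  apply: (@differentiable_comp _ _ _ _ (fun t : R => a + t *: b) f).
    exact: differentiable_line.
  exact: fd.
rewrite (_ : (fun t => _) = fun t : R => 'D_(s *: b) f (a + t *: b)).
  exact: (IH ('D_(s *: b) f) (fC _)).
by apply/funext => t; rewrite -derive_line.
Qed.

Lemma smooth_in_differentiable (U : set V) (f : V -> W) (x : V) :
  smooth_in U f -> U x -> differentiable f x.
Proof. by move=> /(_ 1%N)[fd _]; exact: fd. Qed.

End SmoothCurves.

Lemma derive_comp {R : realType} {U V W : normedModType R}
    (f : U -> V) (g : V -> W) (x v : U) :
  differentiable f x -> differentiable g (f x) ->
  'D_v (g \o f) x = 'd g (f x) ('d f x v).
Proof.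
move=> df dg; rewrite deriveE; first by rewrite diff_comp.
exact: differentiable_comp.
Qed.

(** * Tangent spaces, and Riemannian versus Euclidean gradients *)

Section TangentSpace.
Context {R : realType} {m n : nat}.
Local Notation E := 'M[R]_(m, n).
Implicit Types (M V : set E) (Psi h : E -> R) (x v y d : E).

Lemma curve_differentiable M x (c : R -> E) :
  curve_through M x c -> differentiable c 0.
Proof.
move=> [e e0 [_ cs _]]; apply: (smooth_in_differentiable cs); exact: ballxx.
Qed.

Lemma near_curve M x (c : R -> E) (A : set E) : curve_through M x c ->
  nbhs x A -> \forall t \near (0 : R), A (c t) /\ M (c t).
Proof.
move=> cx xA; have /differentiable_continuous cc := curve_differentiable cx.
have [e e0 [c0 _ cM]] := cx.
apply: filterI; first by apply: cc; rewrite c0.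
by apply/nbhs_ballP; exists e.
Qed.

(* In a slice chart phi the tangent space at x is the preimage of the slice
   under the differential of phi. *)
Lemma tangent_vspace M x : embedded_submanifold M -> M x ->
  exists W : {vspace E}, forall v, tangent M x v <-> v \in W.
Proof.
move=> [dim HM] Mx; have [U [U' [phi [psi [W]]]]] := HM x Mx.
move=> [[oU Ux oU'] [sphi spsi] phiK psiK [_ MW]].
have dphi : differentiable phi x := smooth_in_differentiable sphi Ux.
have [U'x psix] := phiK _ Ux.
have dpsi : differentiable psi (phi x) := smooth_in_differentiable spsi U'x.
have phixW : phi x \in W by apply/MW.
have nU : nbhs x U by exact: open_nbhs_nbhs.
exists (linfun ('d phi x) @^-1: W)%VS => v; rewrite -memv_preim lfunE /=; split.
  move=> [c cx <-]; have dc := curve_differentiable cx.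
  have c0 : c 0 = x by case: cx => e _ [].
  have dphi0 : differentiable phi (c 0) by rewrite c0.
  have dphic : differentiable (phi \o c) 0 by exact: differentiable_comp.
  (* Near 0 the curve [phi \o c] stays in [W], so composing it with the projection [p] onto [W]
     changes nothing; its velocity is then a value of [p], hence lies in [W]. *)
  pose p : {linear E -> E} := fun_of_lfun (projv W).
  have pC : continuous p by exact: linear_mx_continuous.
  have dp y : differentiable p y by exact: linear_differentiable.
  rewrite derive1E' //.
  have -> : 'd phi x ('d c 0 1) = 'D_1 (phi \o c) 0.
    by rewrite (derive_comp _ dc dphi0) c0.
  have -> : 'D_1 (phi \o c) 0 = 'D_1 (p \o (phi \o c)) 0.
    apply: near_eq_derive; apply: filterS (near_curve cx nU) => t [Ut Mt].
    by rewrite /= /p projv_id //; apply/MW.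
  by rewrite (derive_comp _ dphic (dp _)) diff_lin // /p memv_proj.
(* Conversely, the line through [phi x] with direction [b] stays in [W]; its image under [psi] is a
   curve in [M], whose velocity is [v] because [psi \o phi] is the identity near [x]. *)
move=> vW; set b := 'd phi x v in vW.
have nU' : \forall t \near (0 : R), U' (phi x + t *: b).
  have : continuous_at 0 (fun t : R => phi x + t *: b).
    exact/differentiable_continuous/differentiable_line.
  by apply; rewrite scale0r addr0; exact: open_nbhs_nbhs.
have [e /= e0 eU'] := (nbhs_ballP _ _).1 nU'.
exists (fun t => psi (phi x + t *: b)).
  exists e => //; split; first by rewrite scale0r addr0.
    by move=> k; apply: Ck_subset (Ck_line (phi x) b (spsi k)).
  move=> t /eU' /psiK[Ut phit]; apply/MW => //.
  by rewrite phit memvD // memvZ.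
rewrite derive1E derive_line scale0r addr0 scale1r deriveE // /b.
have -> : 'd psi (phi x) ('d phi x v) = 'D_v (psi \o phi) x.
  by rewrite (derive_comp _ dphi dpsi).
have -> : 'D_v (psi \o phi) x = 'D_v id x.
  by apply: near_eq_derive; apply: filterS nU => y /phiK[].
by rewrite derive_id.
Qed.

(** The map [T] pairs a vector with a basis of [W]. It is injective on [W] because the inner product
    is definite, hence onto by a dimension count, and a preimage of the values of [l] on the basis
    represents [l]. *)
Lemma riesz_vspace (W : {vspace E}) (l : {linear E -> R}) :
  exists2 v, v \in W & forall u, u \in W -> frob_ip v u = l u.
Proof.
set k := \dim W; set b := vbasis W.
pose T v : 'rV[R]_k := \row_i frob_ip v b`_i.
have Tlin : linear T.
  by move=> a u v; apply/rowP => i; rewrite !mxE frob_ipDl frob_ipZl.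
pose TL : {linear _ -> _} := HB.pack T (GRing.isLinear.Build _ _ _ _ T Tlin).
have ext v u : u \in W -> frob_ip v u = \sum_i coord b i u * frob_ip v b`_i.
  move=> uW; rewrite [in LHS](coord_vbasis uW).
  elim/big_ind2 : _ => [|? ? ? ? <- <-|i _]; first exact: frob_ip0r.
    by rewrite frob_ipDr.
  by rewrite frob_ipZr.
have ker0 : (W :&: lker (linfun TL) = 0)%VS.
  apply/eqP; rewrite -subv0; apply/subvP => v.
  rewrite memv_cap memv_ker lfunE /= memv0 => /andP[vW /eqP Tv0].
  apply/eqP/frob_ip_eq0; rewrite (ext v v vW) big1 // => i _.
  by have /rowP/(_ i) := Tv0; rewrite !mxE => ->; rewrite mulr0.
have full : (linfun TL @: W = fullv)%VS.
  apply/eqP; rewrite -dimv_leqif_eq ?subvf // dimvf /dim /= mul1n.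
  by have := limg_ker_dim (linfun TL) W; rewrite ker0 dimv0 add0n => ->.
have : \row_i l b`_i \in (linfun TL @: W)%VS by rewrite full memvf.
move=> /memv_imgP[v vW]; rewrite lfunE /= => Tv; exists v => // u uW.
rewrite (ext v u uW) [in RHS](coord_vbasis uW) linear_sum.
apply: eq_bigr => i _; rewrite linearZ /=.
by have /rowP/(_ i) := Tv; rewrite !mxE => ->.
Qed.

(** Uniqueness is what pins down the value of the choice operator in [egrad]. The two expansions are
    compared at a small multiple of the difference [w = u - v], which is itself a vector of [V]. *)
Lemma is_egrad_unique (W : {vspace E}) V h y u v :
  (forall w, V w <-> w \in W) -> is_egrad V h y u -> is_egrad V h y v -> u = v.
Proof.
move=> VW [Vu hu] [Vv hv]; apply/eqP; rewrite -subr_eq0; apply/eqP.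
set w := u - v; have Vw : V w by apply/VW; rewrite memvB //; exact/VW.
apply: frob_ip_eq0; apply/eqP; rewrite eq_le frob_ip_ge0 andbT.
have [w0|w0] := eqVneq `|w| 0; first by rewrite (normr0_eq0 w0) frob_ip0r.
apply/ler_addgt0Pr => e e0; rewrite add0r.
have w_gt0 : 0 < `|w| by rewrite lt0r w0 normr_ge0.
(* Two errors [e' * |t *: w|], divided by [t], add up to exactly [e]; the factor [t] below places
   [t *: w] at half the admissible radius. *)
pose e' := e / (2 * `|w|).
have e'0 : 0 < e' by rewrite divr_gt0 // mulr_gt0.
have [r /= r0 rP] :=
  (nbhs_norm0P).1 (filterI (hu e' e'0) (hv e' e'0)).
pose t := r / (2 * `|w|); have t0 : 0 < t by rewrite divr_gt0 // mulr_gt0.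
have tw : `|t *: w| = r / 2.
  by rewrite normrZ gtr0_norm // /t invfM mulrA divfK.
have [|] := rP (t *: w); first by rewrite /= tw ltr_pdivrMr // ltr_pMr // ltr1n.
have Vtw : V (t *: w) by apply/VW; rewrite memvZ //; exact/VW.
move=> /(_ Vtw) h1 /(_ Vtw) h2.
have : `|t * frob_ip w w| <= e' * `|t *: w| + e' * `|t *: w|.
  apply: le_trans (lerD h2 h1); apply: le_trans (ler_normB _ _).
  rewrite {1}/w frob_ipDl frob_ipNl !frob_ipZr le_eqVlt; apply/orP; left.
  by apply/eqP; congr (`|_|); lra.
rewrite normrM gtr0_norm // ger0_norm ?frob_ip_ge0 // normrZ gtr0_norm //.
rewrite -mulr2n -mulr_natl !(mulrCA _ t) ler_pM2l // => /le_trans; apply.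
by rewrite mulrCA /e' divfK // mulf_neq0 // pnatr_eq0.
Qed.

Lemma egrad_eq (W : {vspace E}) V h y v :
  (forall w, V w <-> w \in W) -> is_egrad V h y v -> egrad V h y = v.
Proof.
move=> VW hv; apply: (is_egrad_unique VW _ hv).
by apply: (@getPex _ (is_egrad V h y)); exists v.
Qed.

(** At 0 the remainder of the expansion is exactly the quadratic term, which is at most
    [C * |d| ^+ 2]. *)
Lemma is_egrad_model V (Psi0 s : R) (g : E) (F : {linear E -> E}) :
  V g -> is_egrad V (rngd_model Psi0 s g F) 0 g.
Proof.
move=> Vg; split=> // e e0.
have [K K0 FK] := linear_mx_bounded F; set l := s * frob_norm g.
pose C := 1 + (m * n)%:R * (K + `|l|).
have C0 : 0 < C by rewrite ltr_pwDl // mulr_ge0 // addr_ge0 // ltW.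
apply/nbhs_norm0P; exists (e / C) => /=; first exact: divr_gt0.
move=> d /=; rewrite ltr_pdivlMr // => dC _.
rewrite /rngd_model add0r linear0 scaler0 addr0 !frob_ip0r mulr0 !addr0 -/l.
rewrite [X in `|X|](_ : _ = 2^-1 * frob_ip (F d + l *: d) d); last by lra.
rewrite normrM ger0_norm ?invr_ge0 //.
have h : `|frob_ip (F d + l *: d) d| <= C * `|d| * `|d|.
  apply: le_trans (norm_frob_ip_le _ _) _.
  rewrite mulrA ler_wpM2r //.
  apply: (@le_trans _ _ ((m * n)%:R * (K + `|l|) * `|d|)); last first.
    by rewrite ler_wpM2r // /C lerDr.
  rewrite -mulrA ler_wpM2l // mulrDl; apply: le_trans (ler_normD _ _) _.
  by rewrite normrZ lerD2r FK.
apply: (@le_trans _ _ (C * `|d| * `|d|)).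
  by have := normr_ge0 (frob_ip (F d + l *: d) d); lra.
by rewrite ler_wpM2r // mulrC ltW.
Qed.

(** The difference of two candidates is tangent, hence the velocity of some curve; both candidates
    give the same derivative along it, so the difference is orthogonal to itself. *)
Lemma is_rgrad_unique (W : {vspace E}) M Psi x u v :
  (forall w, tangent M x w <-> w \in W) ->
  is_rgrad M Psi x u -> is_rgrad M Psi x v -> u = v.
Proof.
move=> VW [Vu hu] [Vv hv]; apply/eqP; rewrite -subr_eq0; apply/eqP.
have : tangent M x (u - v) by apply/VW; rewrite memvB //; exact/VW.
move=> [c cx cuv]; apply: frob_ip_eq0; rewrite -{2}cuv frob_ipDl frob_ipNl.
by have [_ <-] := hu c cx; have [_ <-] := hv c cx; rewrite subrr.
Qed.

(** Both sides equal the Riesz representative [v] of the differential of a local extension [G] of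
    [Psi]: the left one by the chain rule along curves, the right one because the retraction is the
    identity to first order. *)
Lemma rgrad_eq_egrad M (retr : E -> E -> E) Psi x :
  embedded_submanifold M -> retraction M retr ->
  differentiable_on_manifold M Psi -> M x ->
  rgrad M Psi x = egrad (tangent M x) (Psi \o retr x) 0.
Proof.
move=> HM [_ retrM retr0 dretr] dPsi Mx.
have [W VW] := tangent_vspace HM Mx.
have [G dG GPsi] := dPsi x Mx.
have [v vW vG] := riesz_vspace W ('d G x).
have Gx : G x = Psi x by exact: (nbhs_singleton GPsi).
have Vv : tangent M x v by apply/VW.
have rv : is_rgrad M Psi x v.
  split=> // c cx; have dc := curve_differentiable cx.
  have c0 : c 0 = x by case: cx => e _ [].
  have Vc : derive1 c 0 \in W by apply/VW; exists c.
  have dGc0 : differentiable G (c 0) by rewrite c0.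
  have dGc : differentiable (G \o c) 0 by exact: differentiable_comp.
  apply: (@near_eq_is_derive _ _ _ (G \o c)).
    by apply: filterS (near_curve cx GPsi) => t [+ Mt]; exact.
  split; first exact: diff_derivable.
  by rewrite vG // derive1E' // (derive_comp _ dc dGc0) c0.
have ev : is_egrad (tangent M x) (Psi \o retr x) 0 v.
  split=> // e e0.
  have [K K0 GK] := linear_mx_bounded ('d G x).
  (* The bound 1 gives [|r| <= 2 * |d|], so that the tolerance [e / 4] for [G] costs at most
     [e / 2 * |d|]; the other bound makes the retraction error, amplified by [K], cost the remaining
     [e / 2 * |d|]. *)
  pose e1 := Num.min 1 (e / (2 * K)).
  have e10 : 0 < e1 by rewrite lt_min ltr01 divr_gt0 // mulr_gt0.
  have e40 : 0 < e / 4 by rewrite divr_gt0.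
  have := diff_locally dG => /eqaddoP /(_ (e / 4) e40).
  move=> /nbhs_norm0P[r2 /= r20 hr2].
  have [r3 /= r30 hr3] := (nbhs_ballP _ _).1 GPsi.
  have rmin : 0 < Num.min r2 r3 / 2 by rewrite divr_gt0 // lt_min r20.
  have near_min : \forall d \near (0 : E), `|d| < Num.min r2 r3 / 2.
    by apply/nbhs_norm0P; exists (Num.min r2 r3 / 2).
  apply: filterS2 (dretr x Mx e1 e10) near_min => d hd dlt Vd.
  move: (hd Vd); rewrite !add0r /= retr0 // => hr.
  set r := retr x d - x in hr.
  have dl1 : e1 * `|d| <= `|d| by rewrite ler_piMl // /e1 ge_min lexx.
  have rle : `|r| <= 2 * `|d|.
    rewrite -(subrK d r); apply: le_trans (ler_normD _ _) _.
    by move: hr dl1; lra.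
  have [rr2 rr3] : `|r| < r2 /\ `|r| < r3.
    have [le1 le2] : Num.min r2 r3 <= r2 /\ Num.min r2 r3 <= r3.
      by rewrite !ge_min !lexx orbT.
    by split; lra.
  have retrE : retr x d = r + x by rewrite subrK.
  clearbody r.
  have -> : Psi (retr x d) = G (retr x d).
    apply/esym/hr3; last exact: retrM.
    by rewrite -ball_normE /= distrC retrE addrK.
  rewrite -Gx retrE vG; last exact/VW.
  have hG : `|G (r + x) - (G x + 'd G x r)| <= e / 4 * `|r| := hr2 r rr2.
  have hl : `|'d G x (r - d)| <= K * (e1 * `|d|).
    by apply: le_trans (GK _) _; rewrite ler_wpM2l // ltW.
  have e1K : K * e1 <= e / 2.
    apply: (@le_trans _ _ (K * (e / (2 * K)))).
      by rewrite ler_wpM2l ?(ltW K0) // /e1 ge_min lexx orbT.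
    by rewrite invfM (mulrC 2^-1) !mulrA (mulrC K) mulfK ?gt_eqF.
  have hl' : K * (e1 * `|d|) <= e / 2 * `|d| by rewrite mulrA ler_wpM2r.
  have -> : G (r + x) - G x - 'd G x d =
      (G (r + x) - (G x + 'd G x r)) + 'd G x (r - d).
    by rewrite linearB /= opprD !addrA subrK.
  apply: le_trans (ler_normD _ _) _.
  have h4 : e / 4 * `|r| <= e / 4 * (2 * `|d|) by rewrite ler_wpM2l // ltW.
  by move: hG hl hl' h4; set a := `|G _ - _|; set b := `|'d G x (r - d)|; lra.
rewrite (egrad_eq VW ev); apply: (is_rgrad_unique VW _ rv).
by apply: (@getPex _ (is_rgrad M Psi x)); exists v.
Qed.

End TangentSpace.

(** * The regularized model step: length, decrease and acceptance *)

Section ModelStep.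
Context {R : realType} {m n : nat}.
Local Notation E := 'M[R]_(m, n).
Implicit Types (V : set E) (W : {vspace E}) (F : {linear E -> E}) (g d : E).

Lemma frob_ip_le_op_norm W V F g : (forall w, V w <-> w \in W) -> V g ->
  frob_ip (F g) g <= op_norm V F * frob_norm g ^+ 2.
Proof.
move=> VW Vg; have [g0|g0] := eqVneq (frob_norm g) 0.
  by rewrite g0 (frob_norm_eq0 g0) frob_ip0r expr0n mulr0.
have g_gt0 : 0 < frob_norm g by rewrite lt0r g0 frob_norm_ge0.
rewrite expr2 mulrA; apply: le_trans (frob_ip_le _ _) _.
rewrite ler_wpM2r ?frob_norm_ge0 // -ler_pdivrMr // mulrC.
rewrite -[X in X * _]ger0_norm ?invr_ge0 ?frob_norm_ge0 //.
rewrite -frob_normZ -linearZ; apply: sup_ubound; last first.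
  exists ((frob_norm g)^-1 *: g) => //=; split.
    by apply/VW; rewrite memvZ //; exact/VW.
  by rewrite frob_normZ ger0_norm ?invr_ge0 ?frob_norm_ge0 // mulVf.
have [K K0 FK] := linear_mx_bounded F.
(* For the supremum to be an upper bound, its set must be bounded; [x <= 1 + x ^+ 2] turns a bound
   on the squared norm into one on the norm. *)
exists (1 + (m * n)%:R * (K * K)) => _ /= [d [_ d1] <-].
have Fd : `|F d| <= K.
  apply: le_trans (FK d) _; rewrite ger_pMr //.
  exact: le_trans (norm_le_frob_norm d) d1.
have := norm_frob_ip_le (F d) (F d).
rewrite ger0_norm ?frob_ip_ge0 // -sqr_frob_norm => h.
have : (m * n)%:R * (`|F d| * `|F d|) <= (m * n)%:R * (K * K).
  by rewrite ler_wpM2l // ler_pM.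
by have := frob_norm_ge0 (F d); move: h; nra.
Qed.

Lemma rngd_modelZ (Psi0 s : R) g F d (t : R) :
  rngd_model Psi0 s g F (t *: d) = Psi0 + t * frob_ip g d
    + t ^+ 2 * (2^-1 * frob_ip (F d + (s * frob_norm g) *: d) d).
Proof.
by rewrite /rngd_model linearZZ !frob_ipDl !frob_ipZl !frob_ipZr; lra.
Qed.

(** Stationarity along the ray of [d] gives [- frob_ip g d = b], and [b] is at least
    [l * frob_norm d ^+ 2]. By Cauchy-Schwarz [l * frob_norm d <= frob_norm g], where
    [l = s * frob_norm g]. The bound puts the step inside the ball of the fully linear model. *)
Lemma rngd_step_bound W V (Psi0 s : R) g F d :
  (forall w, V w <-> w \in W) -> sym_psd_on V F -> 0 < s -> 0 < frob_norm g ->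
  argmin_on V (rngd_model Psi0 s g F) d -> frob_norm d <= s^-1.
Proof.
move=> VW [_ _ Fpsd] s0 g0 [Vd dmin].
have [->|d0] := eqVneq (frob_norm d) 0; first by rewrite invr_ge0 ltW.
have d_gt0 : 0 < frob_norm d by rewrite lt0r d0 frob_norm_ge0.
set l := s * frob_norm g; have l0 : 0 < l by exact: mulr_gt0.
pose a := frob_ip g d; pose b := frob_ip (F d + l *: d) d.
have bE : b = frob_ip (F d) d + l * frob_norm d ^+ 2.
  by rewrite /b frob_ipDl frob_ipZl sqr_frob_norm.
have lb : l * frob_norm d ^+ 2 <= b by rewrite bE lerDr Fpsd.
have b0 : 0 < b by apply: lt_le_trans lb; rewrite mulr_gt0 // exprn_gt0.
(* The competitor is the vertex [t = - a / b] of the parabola along the ray; minimality at 1 forces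
   [(t - 1) ^+ 2 <= 0]. *)
have ab : a = - b.
  have := dmin ((- a / b) *: d).
  rewrite -[X in rngd_model _ _ _ _ X <= _]scale1r !rngd_modelZ -/l -/a -/b.
  have /[swap]/[apply] : V ((- a / b) *: d).
    by apply/VW; rewrite memvZ //; exact/VW.
  set t := - a / b; have tb : t * b = - a by rewrite divfK // gt_eqF.
  have -> : a = - (t * b) by rewrite tb opprK.
  move=> h; have : b * (t - 1) ^+ 2 <= 0 by nra.
  rewrite pmulr_rle0 // le_eqVlt ltNge sqr_ge0 orbF sqrf_eq0 subr_eq0 => /eqP ->.
  by rewrite mul1r.
have : l * frob_norm d ^+ 2 <= frob_norm g * frob_norm d.
  apply: le_trans lb _; rewrite -[b]opprK -ab /a -frob_ipNl.
  by rewrite -(frob_normN g) frob_ip_le.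
rewrite expr2 mulrA ler_pM2r // -[leRHS]mul1r /l mulrAC ler_pM2r // => h.
by rewrite -[leRHS]mul1r ler_pdivlMr // mulrC.
Qed.

(* Comparison of the minimiser with -t g, where t = 1 / (2 lambda). *)
Lemma rngd_model_decrease W V (Psi0 s kfim eta2 : R) g F d :
  (forall w, V w <-> w \in W) -> V g -> op_norm V F <= kfim -> kfim <= eta2 ->
  0 < s -> 0 < eta2 -> eta2 / s <= frob_norm g ->
  argmin_on V (rngd_model Psi0 s g F) d ->
  rngd_model Psi0 s g F d <= Psi0 - eta2 / 4 / s ^+ 2.
Proof.
move=> VW Vg Fk ke s0 e0 eg [_ dmin].
have g0 : 0 < frob_norm g by apply: lt_le_trans eg; exact: divr_gt0.
set l := s * frob_norm g; have l0 : 0 < l by exact: mulr_gt0.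
have el : eta2 <= l by move: eg; rewrite ler_pdivrMr // mulrC.
pose t := (2 * l)^-1; have t0 : 0 < t by rewrite invr_gt0 mulr_gt0.
have tl : t * l = 2^-1 by rewrite /t invfM divfK ?gt_eqF.
apply: le_trans (dmin ((- t) *: g) _) _.
  by apply/VW; rewrite memvZ //; exact/VW.
rewrite rngd_modelZ -/l frob_ipDl frob_ipZl -!sqr_frob_norm sqrrN.
set N := frob_norm g ^+ 2.
(* Since [kfim <= eta2 <= l], the regularization dominates [F] along [g]. The quadratic part is then
   at most [t * N / 2], which leaves a decrease of [t * N / 2 = frob_norm g / (4 * s)]. *)
have Fg : frob_ip (F g) g <= l * N.
  apply: le_trans (frob_ip_le_op_norm F VW Vg) _.
  by rewrite ler_wpM2r ?sqr_ge0 // (le_trans Fk) // (le_trans ke).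
have tsN : t * N = 2^-1 * (frob_norm g / s).
  by rewrite /t /N /l invfM expr2 invfM -!mulrA mulKf ?gt_eqF // (mulrC _ s^-1).
have : t ^+ 2 * (2^-1 * (frob_ip (F g) g + l * N)) <= t ^+ 2 * (l * N).
  by rewrite ler_wpM2l ?sqr_ge0 //; lra.
have -> : t ^+ 2 * (l * N) = 2^-1 * (t * N) by rewrite expr2 -tl; lra.
have : eta2 / 4 / s ^+ 2 <= frob_norm g / s / 4.
  rewrite expr2 invfM mulrA (mulrAC eta2 4^-1) (mulrAC _ 4^-1) ler_wpM2r //.
  by rewrite ler_wpM2r // invr_ge0 ltW.
by rewrite mulNr tsN; lra.
Qed.

End ModelStep.

(** The estimate [Pz] exceeds the model value [md] by at most [(epsF + kef) * S <= 2 * kef * S],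
    hence by at most [(1 - eta1) * eta2 / 8 * S]. This is half of [1 - eta1] times the guaranteed
    decrease [eta2 / 4 * S]. *)
Lemma ratio_ge_eta1 {R : realFieldType}
    (eta1 eta2 kef epsF S Pz Pz0 P0 md : R) :
  0 < S -> 0 < eta1 < 1 -> 0 < eta2 -> epsF <= kef ->
  16 * kef / (1 - eta1) <= eta2 -> md <= P0 - eta2 / 4 * S ->
  `|Pz - Pz0| <= epsF * S -> `|Pz0 - md| <= kef * S ->
  eta1 <= (Pz - P0) / (md - P0).
Proof.
move=> S0 /andP[e0 e1] eta20 ek; rewrite ler_pdivrMr ?subr_gt0 // => ke mdle.
rewrite !ler_norml => /andP[_ h1] /andP[_ h2].
have eS : 0 < eta2 * S by exact: mulr_gt0.
rewrite ler_ndivlMr; last by move: mdle eS; lra.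
have : epsF * S <= kef * S by rewrite ler_wpM2r // ltW.
have : 16 * kef * S <= eta2 * (1 - eta1) * S by rewrite ler_wpM2r // ltW.
have : (1 - eta1) * (eta2 / 4 * S) <= (1 - eta1) * (P0 - md).
  by rewrite ler_wpM2l ?subr_ge0 ?(ltW e1) //; lra.
have : 0 <= (1 - eta1) * (eta2 * S) by rewrite mulr_ge0 ?subr_ge0 // ltW.
by lra.
Qed.

(** * Scalar recursion for the regularization parameter *)

Section RegularizationSequence.
Context {R : realType}.
(** Here [psi], [s], [gn], [gr] abstract the objective values, sigma_k, and the norms of g^k and of
    the Riemannian gradient. The recursion for [s] tests only the size of [gn], since the ratio test
    will follow from it. *)
Context (psi s gn gr : nat -> R) (eta gamma smin c keg : R).
Context (s_gt0 : forall k, 0 < s k).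
Context (gamma_gt1 : 1 < gamma) (c_gt0 : 0 < c).
Context (psi_success :
  forall k, eta / s k <= gn k -> psi k.+1 <= psi k - c / s k ^+ 2).
Context (psi_nonincr : forall k, psi k.+1 <= psi k).
Context (s_succ : forall k, s k.+1 =
  if eta / s k < gn k then Num.max smin (s k / gamma) else gamma * s k).
Context (psi_lb : has_lbound (range psi)).

Let psi_le i j : (i <= j)%N -> psi j <= psi i.
Proof.
move=> /subnK <-; elim: (j - i)%N => [|l IH]; first by rewrite add0n.
by rewrite addSn; exact: le_trans (psi_nonincr _) IH.
Qed.

(* Each success with s k < K lowers psi by at least c / K ^+ 2. *)
Lemma eventually_success_large (K : R) : 0 < K ->
  exists N, forall k, (N <= k)%N -> eta / s k < gn k -> K <= s k.
Proof.
move=> K0; apply: contrapT => /forallNP noN.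
have del0 : 0 < c / K ^+ 2 by rewrite divr_gt0 // exprn_gt0.
have drop j : exists k, psi k <= psi 0%N - j%:R * (c / K ^+ 2).
  elim: j => [|j [k kj]]; first by exists 0%N; rewrite mul0r subr0.
  have /existsNP[l /not_implyP[kl /not_implyP[gl /negP]]] := noN k.
  rewrite -ltNge => sl; exists l.+1.
  have := psi_success (ltW gl).
  have : c / K ^+ 2 <= c / s l ^+ 2.
    rewrite ler_wpM2l ?(ltW c_gt0) // lef_pV2 ?posrE ?exprn_gt0 //.
    by rewrite ler_pXn2r ?nnegrE ?ltW.
  by have := psi_le kl; rewrite -natr1 mulrDl mul1r; lra.
have [B Blb] := psi_lb.
pose j := (Num.truncn ((psi 0%N - B) / (c / K ^+ 2))).+1.
have [k] := drop j.
have Bk : B <= psi k by apply: Blb; exists k.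
have : psi 0%N - B < j%:R * (c / K ^+ 2).
  by rewrite -ltr_pdivrMr // truncnS_gt.
by lra.
Qed.

(** Late successes occur only when [s] is at least [gamma * K], so dividing by [gamma] cannot bring
    it below [K]. As long as it is below [K], every late step multiplies it by [gamma], so it
    reaches [K]. *)
Lemma regularization_diverges (K : R) :
  exists N, forall k, (N <= k)%N -> K <= s k.
Proof.
wlog K0 : K / 0 < K => [H|].
  have [//|K0] := ltP 0 K; first exact: H.
  by exists 0%N => k _; exact: le_trans K0 (ltW (s_gt0 k)).
have g0 : 0 < gamma by apply: lt_trans gamma_gt1.
have [N HN] := eventually_success_large (mulr_gt0 g0 K0).
have step k : (N <= k)%N -> K <= s k -> K <= s k.+1.
  move=> Nk Ks; rewrite s_succ; case: ifPn => [/(HN _ Nk) h|_].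
    by rewrite le_max; apply/orP; right; rewrite ler_pdivlMr // mulrC.
  by apply: le_trans Ks _; rewrite ler_peMl ?(ltW (s_gt0 k)) // ltW.
have [k0 Nk0 Kk0] : exists2 k0, (N <= k0)%N & K <= s k0.
  apply: contrapT => noK.
  have sK k : (N <= k)%N -> s k < K.
    by move=> Nk; rewrite ltNge; apply/negP => Ks; apply: noK; exists k.
  (* A linear, Bernoulli-type lower bound on the geometric growth is enough to pass [K]. *)
  have growth j : s N * (1 + j%:R * (gamma - 1)) <= s (j + N)%N.
    elim: j => [|j IH]; first by rewrite mul0r addr0 mulr1 add0n.
    have Nj : (N <= j + N)%N by rewrite leq_addl.
    rewrite addSn s_succ; case: ifPn => [/(HN _ Nj)|_].
      have := sK _ Nj; rewrite ltNge => /negP nK h; exfalso; apply: nK.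
      by apply: le_trans h; rewrite ler_peMl // ltW.
    have : s N <= s (j + N)%N.
      apply: le_trans IH; rewrite ler_peMr ?(ltW (s_gt0 N)) // lerDl.
      by rewrite mulr_ge0 // subr_ge0 ltW.
    rewrite -natr1; move: IH => /= IH h.
    have := ler_wpM2r (_ : 0 <= gamma - 1) h; rewrite subr_ge0 ltW // => /(_ isT).
    by move: IH; lra.
  have gN : 0 < s N * (gamma - 1) by rewrite mulr_gt0 // subr_gt0.
  set j := (Num.truncn (K / (s N * (gamma - 1)))).+1.
  have := growth j; have := sK (j + N)%N (leq_addl _ _).
  have : K < j%:R * (s N * (gamma - 1)) by rewrite -ltr_pdivrMr // truncnS_gt.
  by have := s_gt0 N; lra.
exists k0 => k /subnK <-; elim: (k - k0)%N => [|j IH]; first by rewrite add0n.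
by rewrite addSn; apply: step => //; rewrite (leq_trans Nk0) // leq_addl.
Qed.

(* If gr stayed above e, all late steps would be successes, making s eventually
   nonincreasing. *)
Lemma gradient_frequently_small :
  (forall k, gr k <= gn k + keg / s k) ->
  forall (e : R) N, 0 < e -> exists2 k, (N <= k)%N & gr k < e.
Proof.
move=> grn e N e0; apply: contrapT => nogr.
have gre k : (N <= k)%N -> e <= gr k.
  by move=> Nk; rewrite leNgt; apply/negP => gk; apply: nogr; exists k.
(* Beyond this threshold [(keg + eta) / s k < e], the summand 1 giving strictness, so every step is
   a success; [smin <= s k] ensures that the truncation at [smin] does not raise [s]. *)
have [N1 HN1] := regularization_diverges (Num.max smin ((keg + eta + 1) / e)).
set N2 := maxn N N1.
have noninc k : (N2 <= k)%N -> s k.+1 <= s k.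
  rewrite geq_max => /andP[Nk N1k]; have := HN1 k N1k.
  rewrite ge_max ler_pdivrMr // => /andP[smk ks].
  have sk := s_gt0 k.
  rewrite s_succ ifT; last first.
    apply: (@lt_le_trans _ _ (e - keg / s k)); last first.
      by have := grn k; have := gre k Nk; lra.
    rewrite ltrBrDr -mulrDl ltr_pdivrMr //; lra.
  rewrite ge_max smk ler_pdivrMr ?(lt_trans _ gamma_gt1) //.
  by rewrite ler_peMr // ltW.
have bnd j : s (j + N2)%N <= s N2.
  elim: j => [|j IH]; first by rewrite add0n.
  by rewrite addSn; apply: le_trans (noninc _ _) IH; rewrite leq_addl.
have [N3 HN3] := regularization_diverges (s N2 + 1).
have := HN3 (N3 + N2)%N (leq_addr _ _); have := bnd N3; lra.
Qed.

End RegularizationSequence.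

(** * From scalar sequences to one realization, then to almost sure convergence *)

Lemma limn_einf_eq0 {R : realType} (u : nat -> R) : (forall k, 0 <= u k) ->
  (forall (e : R) N, 0 < e -> exists2 k, (N <= k)%N & u k < e) ->
  limn_einf (fun k => (u k)%:E) = 0%E.
Proof.
move=> u0 usmall; rewrite limn_einf_lim.
rewrite (_ : einfs _ = cst 0%E) ?lim_cst //.
apply/funext => N; rewrite /einfs /cst; apply/eqP; rewrite eq_le.
apply/andP; split; last first.
  by apply: le_ereal_inf_tmp => _ [k _ <-]; rewrite lee_fin.
apply/lee_addgt0Pr => e e0; rewrite add0e.
have [k Nk ke] := usmall e N e0.
apply: (@le_trans _ _ (u k)%:E); last by rewrite lee_fin ltW.
by apply: ereal_inf_lbound; exists k.
Qed.

Lemma rngd_run_liminf {R : realType} {m n : nat} (M : set 'M[R]_(m, n))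
    (retr : 'M[R]_(m, n) -> 'M[R]_(m, n) -> 'M[R]_(m, n))
    (Psi : 'M[R]_(m, n) -> R) theta0
    (sigma0 sigma_min eta1 eta2 gamma kfim kef keg epsF : R)
    theta sigma g (F : nat -> {linear 'M[R]_(m, n) -> 'M[R]_(m, n)})
    Psi0 Psiz d z :
  embedded_submanifold M -> retraction M retr ->
  differentiable_on_manifold M Psi -> M theta0 ->
  0 < sigma0 -> 0 < eta1 < 1 -> 0 < eta2 -> 1 < gamma ->
  kfim <= eta2 -> 16 * kef / (1 - eta1) <= eta2 ->
  epsF <= kef -> epsF <= eta1 * eta2 / 32 ->
  rngd_run M retr theta0 sigma0 sigma_min eta1 eta2 gamma
    theta sigma g F Psi0 Psiz d z ->
  has_lbound [set Psi (theta k) | k in setT] ->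
  (forall k, op_norm (tangent M (theta k)) (F k) <= kfim) ->
  (forall k, fully_linear M retr Psi kef keg (theta k) (sigma k)
     (rngd_model (Psi0 k) (sigma k) (g k) (F k))) ->
  (forall k, accurate Psi epsF (sigma k) (theta k) (z k) (Psi0 k) (Psiz k)) ->
  limn_einf (fun k => (frob_norm (rgrad M Psi (theta k)))%:E) = 0%E.
Proof.
move=> HM Hretr HdPsi Mtheta0 sigma0_gt0 Heta1 eta2_gt0 gamma_gt1.
move=> kfim_le kef_le epsF_kef epsF_le run lb Hfim Hfl Hacc.
have [theta0E sigma0E Vg Fpsd dmin zE upd] := run.
have gamma_gt0 : 0 < gamma by apply: lt_trans gamma_gt1.
have sigma_gt0 k : 0 < sigma k.
  elim: k => [|k IH]; first by rewrite sigma0E.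
  have [_ ->] := upd k; case: ifPn => _; last exact: mulr_gt0.
  by rewrite lt_max (divr_gt0 IH gamma_gt0) orbT.
have Mtheta k : M (theta k).
  elim: k => [|k IH]; first by rewrite theta0E.
  have [-> _] := upd k; case: ifPn => // _; rewrite zE.
  by have [_ rM _ _] := Hretr; apply: rM => //; have [] := dmin k.
have VW k := tangent_vspace HM (Mtheta k).
pose S k := (sigma k ^+ 2)^-1.
have S_gt0 k : 0 < S k by rewrite invr_gt0 exprn_gt0.
pose md k := rngd_model (Psi0 k) (sigma k) (g k) (F k) (d k).
(* The size test on [g k] alone implies the ratio test, so acceptance takes the form required by the
   scalar recursion. *)
have large_g k : eta2 / sigma k <= frob_norm (g k) ->
    md k <= Psi0 k - eta2 / 4 * S k /\
    eta1 <= (Psiz k - Psi0 k) / (md k - Psi0 k).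
  move=> gk; have [W Wk] := VW k.
  have mdk : md k <= Psi0 k - eta2 / 4 * S k.
    exact: (rngd_model_decrease Wk (Vg k) (Hfim k) kfim_le).
  have gk0 : 0 < frob_norm (g k) by apply: lt_le_trans gk; exact: divr_gt0.
  have dk : tangent_ball M (theta k) (sigma k)^-1 (d k).
    split; first by have [] := dmin k.
    exact: (rngd_step_bound Wk (Fpsd k) (sigma_gt0 k) gk0 (dmin k)).
  split=> //; have [_ Psizk] := Hacc k; have [_ Psidk] := Hfl k _ dk.
  apply: (ratio_ge_eta1 (S_gt0 k) Heta1 eta2_gt0 epsF_kef kef_le mdk Psizk).
  by rewrite zE.
have [e1_gt0 e1_lt1] := andP Heta1.
(* The accepted ratio yields [eta1 * eta2 / 4], and the two estimates lose at most
   [2 * epsF <= eta1 * eta2 / 16], all times [S k]; the net [3 / 16] is rounded down to [1 / 8]. *)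
have decrease k : eta2 / sigma k <= frob_norm (g k) ->
    Psi (theta k.+1) <= Psi (theta k) - eta1 * eta2 / 8 / sigma k ^+ 2.
  move=> gk; have [mdk rho] := large_g k gk.
  have [-> _] := upd k; rewrite -/(md k) rho gk /= -/(S k).
  have eS : 0 < eta2 * S k by rewrite mulr_gt0.
  have neg : md k - Psi0 k < 0 by move: mdk eS; lra.
  have [+ +] := Hacc k; rewrite !ler_norml -/(S k) => /andP[_ h0] /andP[h1 _].
  have := ler_wpM2r (ltW (S_gt0 k)) epsF_le.
  have := ler_wpM2l (ltW e1_gt0) mdk.
  have := mulr_gt0 e1_gt0 eS.
  by move: rho; rewrite ler_ndivlMr //; lra.
apply: limn_einf_eq0 => [k|]; first exact: frob_norm_ge0.
apply: (@gradient_frequently_small _ (fun k => Psi (theta k)) sigma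
  (fun k => frob_norm (g k)) _ eta2 gamma sigma_min (eta1 * eta2 / 8) keg) => //.
- by rewrite divr_gt0 // mulr_gt0.
- move=> k; have [gk|gk] := leP (eta2 / sigma k) (frob_norm (g k)).
    apply: le_trans (decrease k gk) _; rewrite gerBl divr_ge0 ?sqr_ge0 //.
    by rewrite divr_ge0 // mulr_ge0 // ltW.
  by have [-> _] := upd k; rewrite (leNgt _ (frob_norm _)) gk andbF.
- move=> k; have [_ ->] := upd k; rewrite -/(md k).
  case: (boolP (_ < frob_norm _)) => [gk|_]; last by rewrite andbF.
  by have [_ ->] := large_g k (ltW gk).
- move=> k; have [W Wk] := VW k.
  rewrite (rgrad_eq_egrad HM Hretr HdPsi (Mtheta k)).
  (* Full linearity is used at 0, where the two gradients are those of [Psi] and of the model, the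
     latter being [g k]; this gives the error [keg / sigma k]. *)
  have V0 : tangent_ball M (theta k) (sigma k)^-1 0.
    split; first by apply/Wk; exact: mem0v.
    by rewrite frob_norm0 invr_ge0 ltW.
  have [+ _] := Hfl k 0 V0.
  rewrite (egrad_eq Wk (is_egrad_model (Psi0 k) (sigma k) (F k) (Vg k))) => h.
  set G := egrad _ _ _ in h *; rewrite -(subrK (g k) G) addrC.
  by apply: le_trans (frob_norm_triangle _ _) _; rewrite lerD2l.
Qed.

Theorem theorem5p5 (R : realType) (m n : nat)
  (* the manifold, the retraction and the objective *)
  (M : set 'M[R]_(m, n)) (HM : embedded_submanifold M)
  (retr : 'M[R]_(m, n) -> 'M[R]_(m, n) -> 'M[R]_(m, n))
  (Hretr : retraction M retr)
  (X : choiceType) (dY : measure_display) (Y : measurableType dY) (Z : Type)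
  (nu : {measure set Y -> \bar R})
  (data : {fset X * Y}) (f : X -> 'M[R]_(m, n) -> Z)
  (p : Z -> Y -> R) (Hp : conditional_density nu p)
  (Psi : 'M[R]_(m, n) -> R) (HPsi : Psi = neg_log_likelihood data f p)
  (HdPsi : differentiable_on_manifold M Psi)
  (* the parameters and the random run of the algorithm *)
  (theta0 : 'M[R]_(m, n)) (Htheta0 : M theta0)
  (sigma0 sigma_min eta1 eta2 gamma : R)
  (Hsigma0 : 0 < sigma0) (Hsigma_min : 0 < sigma_min)
  (Heta1 : 0 < eta1 < 1) (Heta2 : 0 < eta2) (Hgamma : 1 < gamma)
  (dO : measure_display) (Omega : measurableType dO) (P : probability Omega R)
  (theta : nat -> Omega -> 'M[R]_(m, n)) (sigma : nat -> Omega -> R)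
  (g : nat -> Omega -> 'M[R]_(m, n))
  (F : nat -> Omega -> {linear 'M[R]_(m, n) -> 'M[R]_(m, n)})
  (Psi0 Psiz : nat -> Omega -> R)
  (d z : nat -> Omega -> 'M[R]_(m, n))
  (Hg : forall k i j, measurable_fun setT (fun w => g k w i j))
  (HF : forall k u i j, measurable_fun setT (fun w => F k w u i j))
  (HPsi0 : forall k, measurable_fun setT (Psi0 k))
  (HPsiz : forall k, measurable_fun setT (Psiz k))
  (Hrun : forall w, rngd_run M retr theta0 sigma0 sigma_min eta1 eta2 gamma
     (theta ^~ w) (sigma ^~ w) (g ^~ w) (F ^~ w) (Psi0 ^~ w) (Psiz ^~ w)
     (d ^~ w) (z ^~ w))
  (* (i) *)
  (L : R)
  (Hlb : {ae P, forall w, has_lbound [set Psi (theta k w) | k in setT]})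
  (HL : {ae P, forall w, forall k,
     lipschitz_with_grad (tangent M (theta k w))
       (tangent_ball M (theta k w) sigma_min^-1) L (Psi \o retr (theta k w))})
  (* (ii) *)
  (kfim : R)
  (Hfim : {ae P, forall w, forall k,
     op_norm (tangent M (theta k w)) (F k w) <= kfim})
  (* (iii) *)
  (kef keg : R) (Hkef : 0 < kef) (Hkeg : 0 < keg)
  (Hfl : {ae P, forall w, forall k,
     fully_linear M retr Psi kef keg (theta k w) (sigma k w)
       (rngd_model (Psi0 k w) (sigma k w) (g k w) (F k w))})
  (* (iv) *)
  (epsF : R) (HepsF : 0 < epsF)
  (Hacc : {ae P, forall w, forall k,
     accurate Psi epsF (sigma k w) (theta k w) (z k w) (Psi0 k w) (Psiz k w)})
  (* (v) *)
  (Hv1 : Num.max kfim (16 * kef / (1 - eta1)) <= eta2)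
  (Hv2 : epsF <= Num.min kef (eta1 * eta2 / 32)) :
  {ae P, forall w,
     (limn_einf (fun k => (frob_norm (rgrad M Psi (theta k w)))%:E) = 0)%E}.
Proof.
(* Each almost sure condition already covers all k, so intersecting four events of full measure
   leaves a purely deterministic statement. *)
apply: filterS (filterI Hlb (filterI Hfim (filterI Hfl Hacc))).
move=> w [lb [Fk [fl acc]]].
move: Hv1 Hv2; rewrite ge_max le_min => /andP[h1 h2] /andP[h3 h4].
exact: (rngd_run_liminf HM Hretr HdPsi Htheta0 Hsigma0 Heta1 Heta2 Hgamma
  h1 h2 h3 h4 (Hrun w) lb Fk fl acc).
Qed.
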